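(* Let $w=a^hb^ia^jb^k$ be an effective word. Then: (a) The only abelian squares contained in $w$ are trivial. (b) The number of distinct abelian squares in $w$ is $\left\lfloor \frac{|w|_a+2}{4}\right\rfloor+\left\lfloor \frac{|w|_b+2}{4}\right\rfloor$. (c) This number is at least $\lfloor |w|/4\rfloor$.
   Context: Words are over the alphabet $\{a,b\}$. For a word $u$, $|u|$ is its length, $|u|_a$ and $|u|_b$ are the numbers of $a$'s and $b$'s in $u$, and its Parikh vector is $\mathcal{P}(u)=[|u|_a,|u|_b]$. A factor of a word is a contiguous subword. An abelian square is a word $uv$ with $|u|=|v|\ge 1$ and $\mathcal{P}(u)=\mathcal{P}(v)$; a word contains it if it is a factor of that word. An abelian square is trivial if it has the form $a^{2m}$ or $b^{2m}$ for some positive integer $m$. For an integer $n\ge 4$, the effective partition of $n$ is the ordered pair $e(n)=[p,q]$ of positive integers such that (i) $p+q=n$, (ii) $q>p$, (iii) $q$ is odd, and (iv) $q$ is as small as possible consistent with (i), (ii), (iii). These conditions determine $e(n)$ uniquely. A word $w$ is an effective word if it has the form $w=a^hb^ia^jb^k$ where $[h,j]$ is the effective partition of $|w|_a$ and $[k,i]$ is the effective partition of $|w|_b$ (so $h<j$ and $k<i$, and $|w|_a,|w|_b\ge 4$). *)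

(* Defs.v *)
From HB Require Import structures.
From mathcomp Require Import all_boot.

Set Implicit Arguments.
Unset Strict Implicit.
Unset Printing Implicit Defensive.

Inductive letter := La | Lb.

Definition bool_of_letter (x : letter) : bool := if x is La then true else false.
Definition letter_of_bool (c : bool) : letter := if c then La else Lb.

Lemma bool_of_letterK : cancel bool_of_letter letter_of_bool.
Proof. by case. Qed.

HB.instance Definition _ := Finite.copy letter (can_type bool_of_letterK).

Definition word := seq letter.

Definition parikh (u : word) : nat * nat := (count_mem La u, count_mem Lb u).

(* The existential ranges over all cut points of x; abelian_squareP gives the
   equivalent formulation by a factorization x = u ++ v. *)
Definition abelian_square (x : word) : bool :=
  [exists n : 'I_(size x).+1,
    let u := take n x in let v := drop n x in
    [&& size u == size v, 0 < size u & parikh u == parikh v]].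

Lemma abelian_squareP (x : word) :
  reflect (exists u v : word,
             [/\ x = u ++ v, size u = size v, 0 < size u & parikh u = parikh v])
          (abelian_square x).
Proof.
apply: (iffP existsP) => [[n /and3P[/eqP szE sz_gt0 /eqP pE]] | [u [v [-> szE sz_gt0 pE]]]].
  by exists (take n x), (drop n x); rewrite cat_take_drop.
have lt_u : size u < (size (u ++ v)).+1 by rewrite ltnS size_cat leq_addr.
exists (Ordinal lt_u).
by rewrite /= take_size_cat // drop_size_cat // sz_gt0 szE pE !eqxx.
Qed.

Definition trivial_abelian_square (x : word) : Prop :=
  exists2 m : nat, 0 < m & x = nseq (2 * m) La \/ x = nseq (2 * m) Lb.

(* A factor of w has length at most size w, so it is enough to count inside the
   finite type of words of bounded length. *)
Definition num_abelian_squares (w : word) : nat :=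
  #|[set x : {bseq (size w) of letter} | abelian_square x && infix x w]|.

Definition odd_partition (n p q : nat) : Prop :=
  [/\ 0 < p, 0 < q, p + q = n, p < q & odd q].

Definition effective_partition (n p q : nat) : Prop :=
  [/\ 4 <= n, odd_partition n p q &
      forall p' q' : nat, odd_partition n p' q' -> q <= q'].

Definition effective_word (w : word) : Prop :=
  exists h i j k : nat,
    [/\ w = nseq h La ++ nseq i Lb ++ nseq j La ++ nseq k Lb,
        effective_partition (count_mem La w) h j
      & effective_partition (count_mem Lb w) k i].

(* Main.v *)
Require Import Defs.
From mathcomp Require Import all_boot.
From mathcomp Require Import zify.

(** Write w = a^h b^i a^j b^k.  The classification of its squares rests on the
    inequalities h < j and k < i and on the parity of i and j; the minimality of
    the effective partitions enters only in the count.

    Let u v be an abelian square in w that meets both letters.  If it meets two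
    blocks of w, one letter occurs in only one of u and v.  If it meets three
    blocks, the whole middle block lies in it, so one letter occurs an odd
    number of times.  If it meets all four, it is a^s b^i a^j b^t with s <= h < j
    and t <= k < i; then u holds (s + j) / 2 > s letters a, so u reaches the
    second block of a's and contains all of b^i, leaving v only t < i letters b.
    So every abelian square in w is a power of one letter.  The formal version
    of this case analysis is linear arithmetic on the positions of the two ends
    and the centre of the square, through the closed form [prefix_La] for the
    number of a's in a prefix of w.

    The distinct squares are then a^(2m) with 1 <= m <= (j - 1) / 2 and b^(2m)
    with 1 <= m <= (i - 1) / 2.  Minimality of the odd part gives j <= h + 4,
    since otherwise moving 2 from j to h would give a smaller odd part; so j is
    determined by h + j, and (j - 1) / 2 = floor ((h + j + 2) / 4).  The lower
    bound is floor ((s + t) / 4) <= floor ((s + 2) / 4) + floor ((t + 2) / 4). *)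

Definition four_blocks (h i j k : nat) : word :=
  nseq h La ++ nseq i Lb ++ nseq j La ++ nseq k Lb.

Lemma size_four_blocks h i j k : size (four_blocks h i j k) = h + i + j + k.
Proof. by rewrite !size_cat !size_nseq !addnA. Qed.

Definition prefix_La (h i j n : nat) : nat := minn n h + minn (n - (h + i)) j.

Lemma count_take_nseq_cat (T : eqType) (x y : T) m n (s : seq T) :
  count_mem x (take n (nseq m y ++ s))
    = (y == x) * minn n m + count_mem x (take (n - m) s).
Proof.
elim: m n => [|m IHm] [|n] /=; rewrite ?subn0 ?minn0 ?min0n ?take0 ?muln0 //.
by rewrite IHm subSS minnSS mulnS addnA.
Qed.

Lemma count_take_four_blocks h i j k n :
  count_mem La (take n (four_blocks h i j k)) = prefix_La h i j n.
Proof.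
rewrite /four_blocks -[nseq k Lb]cats0 !count_take_nseq_cat /= /prefix_La.
lia.
Qed.

Lemma count_prefix_four_blocks h i j k (p s : word) :
  four_blocks h i j k = p ++ s -> count_mem La p = prefix_La h i j (size p).
Proof. by move=> Ew; rewrite -(count_take_four_blocks _ _ _ k) Ew take_size_cat. Qed.

Lemma count_letters (x : word) : count_mem La x + count_mem Lb x = size x.
Proof. by elim: x => //= -[] s <- /=; lia. Qed.

Lemma abelian_square_nseq m c : 0 < m -> abelian_square (nseq (2 * m) c).
Proof.
move=> m_gt0; apply/abelian_squareP; exists (nseq m c), (nseq m c).
by rewrite cat_nseq /ncons -iterD mul2n -addnn /nseq /ncons iterD size_nseq.
Qed.

(** The case analysis on the blocks met by a square, stated for positions: p is
    the start of a factor, m half its length, and c the number of a's in each of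
    its halves. *)
Lemma balanced_prefix_La h i j k p m c :
  h < j -> k < i -> odd i -> odd j -> 0 < m -> p + 2 * m <= h + i + j + k ->
  prefix_La h i j p + c = prefix_La h i j (p + m) ->
  prefix_La h i j p + 2 * c = prefix_La h i j (p + 2 * m) ->
  c = 0 \/ c = m.
Proof.
move=> hj ki oi oj.
(* Parity excludes the factors that meet exactly three blocks. *)
rewrite -(odd_double_half i) -(odd_double_half j) oi oj in hj ki *.
rewrite /prefix_La; lia.
Qed.

Lemma four_blocks_abelian_square_trivial h i j k (x : word) :
  h < j -> k < i -> odd i -> odd j ->
  abelian_square x -> infix x (four_blocks h i j k) -> trivial_abelian_square x.
Proof.
move=> hj ki oi oj /abelian_squareP[u [v [-> szE u0 [uvE _]]]] /infixP[p [s Ew]].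
have Ep := count_prefix_four_blocks _ _ _ _ p _ Ew.
have Epu : count_mem La (p ++ u) = prefix_La h i j (size p + size u).
  by rewrite -size_cat; apply: (@count_prefix_four_blocks _ _ _ k _ (v ++ s));
    rewrite Ew !catA.
have Epuv : count_mem La (p ++ u ++ v) = prefix_La h i j (size p + 2 * size u).
  rewrite mul2n -addnn {2}szE -!size_cat.
  by apply: (@count_prefix_four_blocks _ _ _ k _ s); rewrite Ew !catA.
have := congr1 size Ew; rewrite size_four_blocks !size_cat => szw.
have szuv : size (u ++ v) = 2 * size u by rewrite size_cat -szE mul2n addnn.
have cuv : count_mem La (u ++ v) = 2 * count_mem La u.
  by rewrite count_cat -uvE mul2n addnn.
move: Epu Epuv; rewrite count_cat (count_cat _ p (u ++ v)) cuv Ep => Epu Epuv.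
have [|c0|c1] := @balanced_prefix_La h i j k _ _ _ hj ki oi oj u0 _ Epu Epuv.
- by rewrite szw -szE mul2n -addnn leq_add2l leq_addr.
- exists (size u) => //; right; rewrite -szuv; apply/all_pred1P.
  by rewrite all_count -(count_letters (u ++ v)) cuv c0.
- exists (size u) => //; left; rewrite -szuv; apply/all_pred1P.
  by rewrite all_count cuv szuv c1.
Qed.

Lemma infix_nseq_La h i j k n :
  h < j -> 0 < i -> infix (nseq n La) (four_blocks h i j k) = (n <= j).
Proof.
move=> hj i0; apply/infixP/idP => [[p [s Ew]]|nj].
  have Ep := count_prefix_four_blocks _ _ _ _ p _ Ew.
  have := @count_prefix_four_blocks h i j k (p ++ nseq n La) s.
  rewrite -catA => /(_ Ew); rewrite count_cat size_cat Ep count_nseq size_nseq /=.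
  by rewrite /prefix_La; lia.
exists (nseq h La ++ nseq i Lb), (nseq (j - n) La ++ nseq k Lb).
by rewrite -!catA (catA (nseq n La)) -nseqD subnKC.
Qed.

Lemma infix_nseq_Lb h i j k n :
  k < i -> 0 < j -> infix (nseq n Lb) (four_blocks h i j k) = (n <= i).
Proof.
move=> ki j0; apply/infixP/idP => [[p [s Ew]]|ni].
  have Ep := count_prefix_four_blocks _ _ _ _ p _ Ew.
  have := @count_prefix_four_blocks h i j k (p ++ nseq n Lb) s.
  rewrite -catA => /(_ Ew); rewrite count_cat size_cat Ep count_nseq size_nseq /=.
  have := congr1 size Ew; rewrite size_four_blocks !size_cat size_nseq.
  by move: (size p) (size s) => P S; rewrite /prefix_La; lia.
exists (nseq h La), (nseq (i - n) Lb ++ nseq j La ++ nseq k Lb).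
by rewrite /four_blocks (catA (nseq n Lb)) -nseqD subnKC.
Qed.

(** An enumeration by plain words avoids constructing elements of the type of
    words of bounded length: a factor of w satisfies the bound automatically. *)
Lemma num_abelian_squares_enum (w : word) (l : seq word) :
  uniq l -> (forall x, (x \in l) = abelian_square x && infix x w) ->
  num_abelian_squares w = size l.
Proof.
move=> ul lE; rewrite /num_abelian_squares cardE.
rewrite -(size_map val); apply/perm_size/uniq_perm => //.
  by rewrite (map_inj_uniq val_inj) enum_uniq.
move=> x; rewrite lE; apply/mapP/idP => [[y]|xw].
  by rewrite mem_enum inE => yw ->.
have szx : size x <= size w by case/andP: xw => _ /size_infix.
by exists (Bseq szx); rewrite ?mem_enum ?inE.
Qed.

Definition even_powers (c : letter) (n : nat) : seq word :=
  [seq nseq (2 * m) c | m <- iota 1 n].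

Lemma uniq_even_powers c n : uniq (even_powers c n).
Proof.
rewrite map_inj_uniq ?iota_uniq // => m m' /(congr1 size).
by rewrite !size_nseq; lia.
Qed.

Lemma num_abelian_squares_four_blocks h i j k :
  h < j -> k < i -> odd i -> odd j ->
  num_abelian_squares (four_blocks h i j k) = j./2 + i./2.
Proof.
move=> hj ki oi oj.
rewrite (@num_abelian_squares_enum _ (even_powers La j./2 ++ even_powers Lb i./2)).
- by rewrite size_cat !size_map !size_iota.
- rewrite cat_uniq !uniq_even_powers andbT /=; apply/hasPn => x /mapP[m].
  rewrite mem_iota => /andP[m0 _] {x}->; apply/mapP => -[m' _].
  by case: m m0 => // m _; rewrite mulnS; case: (2 * m').
- move=> x; rewrite mem_cat; apply/orP/andP.
    case=> /mapP[m]; rewrite mem_iota => /andP[m0 m_lt] ->.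
      by split; [exact: abelian_square_nseq | rewrite infix_nseq_La; lia].
    by split; [exact: abelian_square_nseq | rewrite infix_nseq_Lb; lia].
  case=> sqx xw.
  have [m m0 [xE|xE]] :=
    four_blocks_abelian_square_trivial _ _ _ _ x hj ki oi oj sqx xw.
    left; rewrite xE in xw *; apply/mapP; exists m => //; rewrite mem_iota.
    by move: xw; rewrite infix_nseq_La; lia.
  right; rewrite xE in xw *; apply/mapP; exists m => //; rewrite mem_iota.
  by move: xw; rewrite infix_nseq_Lb; lia.
Qed.

(** If q exceeded p + 4, then (p + 2, q - 2) would be an admissible partition with
    smaller odd part; so q - p is at most 4, and n determines the odd number q. *)
Lemma effective_partition_half n p q :
  effective_partition n p q -> q./2 = (n + 2) %/ 4.
Proof.
move=> [n4 [p0 q0 pqn pq oq] qmin].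
have q_le : q <= p + 4.
  rewrite leqNgt; apply/negP => lt_q.
  suff /qmin : odd_partition n (p + 2) (q - 2) by lia.
  by split; lia.
lia.
Qed.

Theorem theorem12 (w : word) (hw : effective_word w) :
  [/\ (forall x : word, abelian_square x -> infix x w -> trivial_abelian_square x),
      num_abelian_squares w = (count_mem La w + 2) %/ 4 + (count_mem Lb w + 2) %/ 4
    & size w %/ 4 <= num_abelian_squares w].
Proof.
have [h [i [j [k [wE ha kb]]]]] := hw.
have [_ [_ _ _ hj oj] _] := ha; have [_ [_ _ _ ki oi] _] := kb.
have numE : num_abelian_squares w
    = (count_mem La w + 2) %/ 4 + (count_mem Lb w + 2) %/ 4.
  rewrite -(effective_partition_half _ _ _ ha) -(effective_partition_half _ _ _ kb).
  by rewrite wE num_abelian_squares_four_blocks.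
split=> //; last by rewrite numE -count_letters; lia.
by move=> x sqx; rewrite wE; apply: four_blocks_abelian_square_trivial.
Qed.
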